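(* Let $k\geqslant 1$ and $\Delta\geqslant 3$ be integers. Then there are only finitely many (finite, simple, connected) graphs $G$ of maximum degree $\Delta$ such that $g_k(G)<k-2$.
   Context: For integers $k\geqslant 1$ and $\Delta\geqslant 3$, let $f(k,\Delta)=\Delta\sum_{i=0}^{k-1}(\Delta-1)^i$ (the number of non-root nodes of a $\Delta$-ary tree of height $k$). For a graph $G$, its $k$-th power $G^k$ is the graph on $V(G)$ in which two distinct vertices are adjacent iff their distance in $G$ is at most $k$. $\chi$ denotes the chromatic number and $\Delta(G)$ the maximum degree of $G$. The $k$-gap of $G$ is $g_k(G)=f(k,\Delta(G))+1-\chi(G^k)$. *)

(* Defs.v *)
From mathcomp Require Import all_boot all_order all_algebra.
Set Implicit Arguments. Unset Strict Implicit. Unset Printing Implicit Defensive.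

(* A finite simple graph is a symmetric irreflexive relation e on a finType T. *)

Definition fkD (k D : nat) : nat := D * \sum_(i < k) (D.-1) ^ i.

Fixpoint within (T : finType) (e : rel T) (n : nat) (x y : T) : bool :=
  match n with
  | 0 => x == y
  | n'.+1 => within e n' x y || [exists z, within e n' x z && e z y]
  end.

Definition graph_pow (T : finType) (e : rel T) (k : nat) : rel T :=
  fun x y => (x != y) && within e k x y.

Definition colorable (T : finType) (g : rel T) (c : nat) : bool :=
  [exists f : {ffun T -> 'I_c},
     [forall x, [forall y, ((x != y) && g x y) ==> (f x != f y)]]].

Lemma colorable_card (T : finType) (g : rel T) : exists c, colorable g c.
Proof.
exists #|T|; apply/existsP; exists [ffun x => enum_rank x].
apply/forallP => x; apply/forallP => y; apply/implyP => /andP [nxy _].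
rewrite !ffunE; apply: contra nxy => /eqP H; apply/eqP.
exact: enum_rank_inj.
Qed.

Definition chi (T : finType) (g : rel T) : nat := ex_minn (colorable_card g).

Definition max_degree (T : finType) (e : rel T) : nat :=
  \max_(x : T) #|[set y | e x y]|.

Definition connected (T : finType) (e : rel T) : bool :=
  [forall x, [forall y, connect e x y]].

Definition kgap (T : finType) (e : rel T) (k : nat) : int :=
  (fkD k (max_degree e) + 1)%:Z - (chi (graph_pow e k))%:Z.

(* Main.v *)
(** Let [f = fkD k D], the trivial bound on the maximum degree of [G^k]; we color
    [G^k] with [f + 2 - k] colors as soon as [G] contains a long geodesic [v].

    Removing the first [k] vertices of [v] leaves a graph that is [(f - k)]-degenerate
    in [G^k]: any vertex set [A] avoiding them has a vertex with [k] neighbors outside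
    [A].  This gives a partial coloring [psi] with [c = f + 1 - k] colors.
    Then recolor [v 0], [v 1], ... in turn, using one extra color.  The current
    vertex keeps its [psi]-color unless it clashes with a recolored vertex; otherwise
    it takes the extra color if possible, or else any free color, which exists because
    its [k] successors are ignored.  Since [v] is a geodesic, [psi] takes each color at
    most once on these successors: settling a clash creates at most one new clash, and
    none with the extra color.  The number of pending clashes is thus at most [k],
    never grows, and drops each time the extra color is used, so it reaches [0] in
    bounded time, at which point the remaining vertices can keep their [psi]-colors. *)

Require Import Defs.
From mathcomp Require Import all_boot all_order all_algebra.
From mathcomp Require Import zify.
Set Implicit Arguments. Unset Strict Implicit. Unset Printing Implicit Defensive.

(** * Walks and distances *)

Lemma withinD (T : finType) (e : rel T) m n x y z :
  within e m x y -> within e n y z -> within e (m + n) x z.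
Proof.
move=> xy; elim: n z => [|n IHn] z /=; first by move/eqP <-; rewrite addn0.
rewrite addnS /= => /orP [/IHn ->//|/existsP [u /andP [/IHn xu uz]]].
by apply/orP; right; apply/existsP; exists u; rewrite xu.
Qed.

Lemma within1 (T : finType) (e : rel T) x y : e x y -> within e 1 x y.
Proof. by move=> exy; apply/orP; right; apply/existsP; exists x; rewrite eqxx. Qed.

Lemma within_leq (T : finType) (e : rel T) m n x y :
  m <= n -> within e m x y -> within e n x y.
Proof. by move=> /subnKC <- xy; apply: withinD xy _; elim: (n - m) => //= j ->. Qed.

Lemma within_sym (T : finType) (e : rel T) n :
  symmetric e -> symmetric (within e n).
Proof.
move=> es x y; apply/idP/idP; elim: n x y => [|n IHn] x y /=; try by rewrite eq_sym.
- case/orP => [/IHn ->//|/existsP [z /andP [/IHn zx zy]]].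
  by rewrite es in zy; exact: (withinD (within1 zy) zx).
- case/orP => [/IHn ->//|/existsP [z /andP [/IHn zx zy]]].
  by rewrite es in zy; exact: (withinD (within1 zy) zx).
Qed.

Lemma connect_within (T : finType) (e : rel T) x y :
  connect e x y -> exists n, within e n x y.
Proof.
case/connectP => p; elim: p x => [|z p IHp] x /=; first by move=> _ ->; exists 0 => /=.
by case/andP => xz zp /(IHp _ zp) [n zy]; exists (1 + n); apply: withinD (within1 xz) zy.
Qed.

Lemma connect_exit (T : finType) (r : rel T) (W : {set T}) a b :
  connect r a b -> a \in W -> b \notin W ->
  exists x y, [/\ x \in W, y \notin W & r x y].
Proof.
case/connectP => p; elim: p a => [|z p IHp] a /=; first by move=> _ -> ->.
case/andP => az zp eb aW bW; have [zW|zW] := boolP (z \in W); first exact: IHp zp eb zW bW.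
by exists a, z.
Qed.

(** * Sizes of balls and degrees in the power graph *)

Lemma degree_leq (T : finType) (e : rel T) x : #|[set y | e x y]| <= max_degree e.
Proof. exact: (leq_bigmax x). Qed.

Definition ball (T : finType) (e : rel T) n x := [set y | within e n x y].

(** A vertex of a sphere of positive radius has a neighbor one step closer to [x], which leaves at
    most [(max_degree e).-1] neighbors on the next sphere. *)
Lemma card_sphere (T : finType) (e : rel T) n x : symmetric e ->
  #|ball e n.+1 x :\: ball e n x| <= max_degree e * (max_degree e).-1 ^ n.
Proof.
move=> es; elim: n => [|n IHn].
  rewrite expn0 muln1; apply: leq_trans (degree_leq e x); apply: subset_leq_card.
  apply/subsetP => y; rewrite !inE /= => /andP [/negbTE ->] /=.
  by case/existsP => z /andP [/eqP <-].
rewrite expnSr mulnA; apply: leq_trans (leq_mul IHn (leqnn _)).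
set S := _ :\: _; set S' := _ :\: _.
have sub : S \subset \bigcup_(z in S') ([set y | e z y] :\: ball e n.+1 x).
  apply/subsetP => y; rewrite !inE => /andP [nxy xy].
  move: (xy); rewrite [within _ _.+2 _ _]/= => /orP [h|]; first by rewrite /= h in nxy.
  case/existsP => z /andP [xz zy]; apply/bigcupP; exists z; last by rewrite !inE nxy.
  rewrite !inE [within _ n.+1 _ _]xz andbT; apply/negP => h; case/negP: nxy.
  by have := withinD h (within1 zy); rewrite addn1.
apply: leq_trans (subset_leq_card sub) _.
have bcard (P : {set T}) (F : T -> {set T}) :
    #|\bigcup_(z in P) F z| <= \sum_(z in P) #|F z|.
  elim/big_rec2: _ => [|z m A _ h]; first by rewrite cards0.
  by apply: leq_trans (leq_card_setU _ _).1 _; rewrite leq_add2l.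
apply: leq_trans (bcard _ _) _; rewrite -sum_nat_const; apply: leq_sum => z.
rewrite !inE => /andP [nz]; rewrite /= (negbTE nz) /= => /existsP [w /andP [xw wz]].
have lt : #|[set y | e z y] :\: ball e n.+1 x| < #|[set y | e z y]|.
  apply: proper_card; apply/properP; split; first exact: subsetDl.
  by exists w; rewrite !inE; [rewrite es | rewrite /= xw].
by have := degree_leq e z; move: lt; lia.
Qed.

Lemma card_ball (T : finType) (e : rel T) n x : symmetric e ->
  #|ball e n x| <= (fkD n (max_degree e)).+1.
Proof.
move=> es; elim: n => [|n IHn].
  rewrite /fkD big_ord0 muln0 -(cards1 x); apply: subset_leq_card.
  by apply/subsetP => y; rewrite !inE eq_sym.
rewrite /fkD big_ord_recr /= mulnDr -/(fkD _ _).
have sub : ball e n x \subset ball e n.+1 x by apply/subsetP => y; rewrite !inE /= => ->.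
have := card_sphere n x es; rewrite cardsD (setIidPr sub).
by have := subset_leq_card sub; move: IHn; lia.
Qed.

Lemma card_graph_pow (T : finType) (e : rel T) k x : symmetric e ->
  #|[set y | graph_pow e k x y]| <= fkD k (max_degree e).
Proof.
move=> es; rewrite -ltnS; apply: leq_trans (card_ball k x es).
rewrite (cardsD1 x (ball e k x)) inE (within_leq (leq0n k)) ?eqxx //= add1n ltnS.
by apply: subset_leq_card; apply/subsetP => y; rewrite !inE /graph_pow eq_sym.
Qed.

(** * Greedy coloring and degeneracy *)

Lemma fresh_color (T : finType) (Y : {set T}) (F : T -> nat) c :
  #|Y| < c -> exists2 b, b < c & forall y, y \in Y -> F y != b.
Proof.
move=> ltYc; have [/allP h|] := boolP (all (fun b => b \in [seq F y | y in Y]) (iota 0 c)).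
  have := uniq_leq_size (iota_uniq 0 c) h.
  by rewrite size_iota size_map -cardE leqNgt ltYc.
case/allPn => b; rewrite mem_iota => /= bc nb; exists b => // y yY.
by apply: contra nb => /eqP <-; apply: map_f; rewrite mem_enum.
Qed.

(** Take out a vertex with fewer than [c] neighbors in [S], color the rest by induction, then give
    it a color that these neighbors miss. *)
Lemma degenerate_coloring (T : finType) (H : rel T) c (S : {set T}) :
  symmetric H -> irreflexive H ->
  (forall A : {set T}, A \subset S -> A != set0 ->
     exists2 x, x \in A & #|[set y in A | H x y]| < c) ->
  exists F : T -> nat, (forall x, x \in S -> F x < c) /\
    {in S &, forall x y, H x y -> F x != F y}.
Proof.
move=> Hs Hi; have [m] := ubnP #|S|; elim: m S => // m IHm S ltSm degen.
have [->|S0] := eqVneq S set0.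
  by exists (fun=> 0); split=> x; rewrite inE.
have [x xS degx] := degen S (subxx S) S0.
have [| A AS A0|F [Fc Fp]] := IHm (S :\ x).
- by move: ltSm; rewrite (cardsD1 x S) xS; lia.
- by apply: degen A0; apply: subset_trans AS (subsetDl _ _).
have [b bc bP] := fresh_color F degx.
exists (fun y => if y == x then b else F y); split=> [y yS|y z yS zS].
  by case: eqP => // /eqP nyx; apply: Fc; rewrite !inE nyx.
have [->|nyx] := eqVneq y x; have [->|nzx] := eqVneq z x; rewrite ?Hi // => yz.
- by rewrite eq_sym bP // inE zS.
- by rewrite bP // inE yS Hs.
- by apply: Fp => //; rewrite !inE ?nyx ?nzx.
Qed.

(* [x] is a vertex of [A] next to the component of [v 0] in the complement of
   [A]; balls around [x] grow inside that component by a vertex at each step. *)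
Lemma boundary_neighbors (T : finType) (e : rel T) k (v : nat -> T) (A : {set T}) :
  symmetric e -> connected e -> 0 < k ->
  (forall i, i.+1 < k -> e (v i) (v i.+1)) ->
  {in gtn k &, injective v} ->
  (forall i, i < k -> v i \notin A) -> A != set0 ->
  exists2 x, x \in A & k <= #|[set y | (y \notin A) && graph_pow e k x y]|.
Proof.
move=> es ec k0 ve vinj vA /set0Pn [a aA].
pose r := [rel x y | [&& e x y, x \notin A & y \notin A]].
have rs : symmetric r by move=> x y; rewrite /= es; congr andb; rewrite andbC.
pose B := [set y | connect r (v 0) y].
have v0B : v 0 \in B by rewrite inE connect0.
have vB i : i < k -> v i \in B.
  elim: i => // i IHi ik; have := IHi (ltnW ik); rewrite !inE => h.
  apply: connect_trans h (connect1 _); rewrite /= ve //= !vA //; exact: ltnW.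
have BA y : y \in B -> y \notin A.
  move=> yB; apply/negP => yA; have v0A : v 0 \in ~: A by rewrite inE vA.
  rewrite inE in yB.
  have [|u [w [_ + /= /and3P [_ _ wA]]]] := connect_exit yB v0A; first by rewrite inE yA.
  by rewrite inE wA.
have kB : k <= #|B|.
  have un : uniq (mkseq v k) by apply/mkseq_uniqP.
  rewrite -(size_mkseq v k) -(card_uniqP un); apply: subset_leq_card.
  by apply/subsetP => y /mapP [i]; rewrite mem_iota => ik ->; apply: vB.
have /forallP /(_ (v 0)) /forallP /(_ a) v0a := ec.
have aB : a \notin B by apply/negP => /BA; rewrite aA.
have [b [x [bB xB bx]]] := connect_exit v0a v0B aB.
have xA : x \in A.
  apply/negPn/negP => nxA; case/negP: xB; move: (bB); rewrite !inE => h.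
  by apply: connect_trans h (connect1 _); rewrite /= bx nxA BA.
exists x => //.
pose W j := [set y in B | within e j x y].
(* The vertex [b] starts the growth. Later, either the ball already contains all of [B], which has
   at least [k] vertices, or a path inside [B] leaves it along an edge whose far end is a new
   vertex. *)
have WS j : j < k -> j <= #|W j| -> j < #|W j.+1|.
  move=> jk jW; have sub : W j \subset W j.+1.
    by apply/subsetP => y; rewrite !inE => /andP [-> /= ->].
  case: j => [|j] in jk jW sub *.
    apply/card_gt0P; exists b; rewrite inE bB; apply: within1; by rewrite es.
  have [WB|] := boolP (B \subset W j.+1).
    apply: leq_trans (subset_leq_card sub); apply: leq_trans (subset_leq_card WB).
    exact: leq_trans jk kB.
  case/subsetPn => y yB yW; have /card_gt0P [w wW] : 0 < #|W j.+1| by lia.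
  have wy : connect r w y.
    move: wW yB; rewrite !inE => /andP [vw _]; apply: connect_trans.
    by rewrite (sym_connect_sym rs).
  have [p [q [pW qW /= /and3P [pq pA qA]]]] := connect_exit wy wW yW.
  apply: leq_ltn_trans jW _; apply: proper_card; apply/properP; split=> //.
  exists q => //; move: pW; rewrite inE [p \in B]inE => /andP [vp xp]; rewrite inE [q \in B]inE.
  rewrite (connect_trans vp (connect1 _)) /=; last by rewrite pq pA qA.
  by have := withinD xp (within1 pq); rewrite addn1.
have Wk j : j <= k -> j <= #|W j|.
  by elim: j => // j IHj jk; apply: WS => //; apply: IHj; exact: ltnW.
apply: leq_trans (Wk k (leqnn k)) _; apply: subset_leq_card; apply/subsetP => y.
case/setIdP => yB xy; rewrite inE BA // /graph_pow xy andbT /=.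
by apply: contra xB => /eqP ->.
Qed.

(** * Geodesics in large connected graphs *)

Definition geodesic (T : finType) (e : rel T) n (v : nat -> T) :=
  (forall i, i < n -> e (v i) (v i.+1)) /\
  (forall i j m, i <= j <= n -> within e m (v i) (v j) -> j <= i + m).

Lemma walk_within (T : finType) (e : rel T) n (v : nat -> T) i j :
  (forall l, l < n -> e (v l) (v l.+1)) -> i <= j <= n ->
  within e (j - i) (v i) (v j).
Proof.
move=> ve; elim: j => [|j IHj] /andP [ij jn].
  by move: ij; rewrite leqn0 => /eqP ->; rewrite /= eqxx.
move: ij; rewrite leq_eqVlt => /orP [/eqP ->|ij]; first by rewrite subnn /= eqxx.
rewrite subSn // -addn1; apply: withinD (within1 (ve j jn)); apply: IHj; lia.
Qed.

(** [within] only bounds the length from above; minimality forces exactly [n] steps and passes to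
    the last vertex but one. *)
Lemma shortest_walk (T : finType) (e : rel T) n x y :
  within e n x y -> (forall m, within e m x y -> n <= m) ->
  exists v : nat -> T, [/\ v 0 = x, v n = y & forall i, i < n -> e (v i) (v i.+1)].
Proof.
elim: n y => [|n IHn] y; first by move=> /eqP -> _; exists (fun=> y).
move=> /= /orP [xy|/existsP [z /andP [xz zy]]] mn; first by have := mn _ xy; rewrite ltnn.
have [|v [v0 vn ve]] := IHn z xz.
  by move=> m xz'; have := mn _ (withinD xz' (within1 zy)); lia.
exists (fun i => if i <= n then v i else y); split; rewrite ?leq0n ?ltnn // => i.
rewrite ltnS => lin; rewrite lin; move: lin; rewrite leq_eqVlt => /orP [/eqP ->|lin].
  by rewrite ltnn vn.
by rewrite lin; apply: ve.
Qed.

(** A ball of radius [n] cannot cover the graph, so a shortest walk to a vertex outside it has at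
    least [n] steps; its first [n] steps serve. *)
Lemma geodesic_exists (T : finType) (e : rel T) n :
  symmetric e -> connected e -> (fkD n (max_degree e)).+1 < #|T| ->
  exists v, geodesic e n v.
Proof.
move=> es ec big; have /card_gt0P [x _] : 0 < #|T| by lia.
have [y xy] : exists y, ~~ within e n x y.
  apply/existsP; rewrite -negb_forall; apply/negP => /forallP all.
  move: big; rewrite ltnNge; case/negP; apply: leq_trans (card_ball n x es).
  by rewrite -cardsT; apply: subset_leq_card; apply/subsetP => y _; rewrite inE.
have /forallP /(_ x) /forallP /(_ y) /connect_within ex := ec.
case: (ex_minnP ex) => d xyd dmin.
have nd : n <= d by rewrite leqNgt; apply: contra xy => /ltnW /within_leq; apply.
have [v [v0 vd ve]] := shortest_walk xyd dmin.
exists v; split=> [i lin|i j m /andP [ij jn] w]; first by apply: ve; lia.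
have w0 : within e (i - 0) (v 0) (v i) by apply: walk_within ve _; lia.
have w1 : within e (d - j) (v j) (v d) by apply: walk_within ve _; lia.
have := withinD (withinD w0 w) w1; rewrite v0 vd => /dmin; lia.
Qed.

(** * Recoloring along a path, with [H] in the role of the power graph *)

Section Recoloring.

Variables (T : finType) (H : rel T) (k c n : nat) (v : nat -> T) (psi : T -> nat).
Hypothesis k_leq_n : k <= n.
Hypothesis H_sym : symmetric H.
Hypothesis H_path : forall i j, i < j <= n -> H (v i) (v j) = (j - i <= k).
Hypothesis v_inj : forall i j, i <= n -> j <= n -> v i = v j -> i = j.
Hypothesis H_deg : forall x, #|[set y | H x y]| < c + k.
Hypothesis psi_proper : forall x y, H x y -> psi x != psi y.
(** Color [c] is the extra one. Only on the first [k] path vertices may [psi] leave the palette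
    below [c]. *)
Hypothesis psi_neq : forall x, psi x != c.
Hypothesis psi_lt : forall x, (forall j, j < k -> x != v j) -> psi x < c.

Definition tail i := [set x | [exists j : 'I_n.+1, (i <= j) && (x == v j)]].

Lemma tailP i x : reflect (exists2 j, i <= j <= n & x = v j) (x \in tail i).
Proof.
rewrite inE; apply: (iffP existsP) => [[j /andP [ij /eqP ->]]|[j /andP [ij jn] ->]].
  by exists j => //; rewrite ij -ltnS /=.
by exists (Ordinal (jn : j < n.+1)); rewrite /= ij eqxx.
Qed.

Lemma mem_tail i j : j <= n -> (v j \in tail i) = (i <= j).
Proof.
move=> jn; apply/tailP/idP => [[l /andP [il ln] /v_inj -> //]|ij].
by exists j; rewrite ?ij.
Qed.

Lemma tailS i : i <= n -> tail i = v i |: tail i.+1.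
Proof.
move=> lin; apply/setP => x; rewrite in_setU1; apply/tailP/idP.
  case=> j /andP [ij jn] ->; rewrite mem_tail // ltn_neqAle ij andbT.
  by case: (eqVneq i j) => [->|_]; rewrite ?eqxx ?orbT.
case/orP => [/eqP ->|/tailP [j /andP [ij jn] ->]]; first by exists i; rewrite ?leqnn.
by exists j; rewrite // (ltnW ij).
Qed.

(** The state just before [v i] is recolored: properness is required only among the vertices outside
    [tail i]. *)
Definition settled i (F : T -> nat) :=
  [/\ {in tail i, F =1 psi}, {in [predC tail 0], F =1 psi},
      {in [predC tail i], forall x, F x <= c}
    & {in [predC tail i] &, forall x y, H x y -> F x != F y}].

Definition clash i (F : T -> nat) :=
  [set y in tail i | [exists x, [&& x \notin tail i, H x y & F x == psi y]]].

Definition hits i b := [set y in tail i.+1 | H (v i) y && (psi y == b)].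

(** A clash after the step comes either from an earlier settled vertex, so it was already pending,
    or from [v i] with its new color [b]. *)
Lemma settle_next i b F : i <= n -> settled i F -> b <= c ->
  (forall x, x \notin tail i -> H x (v i) -> F x != b) ->
  exists2 F', settled i.+1 F' /\ F' (v i) = b &
    (forall x, x != v i -> F' x = F x) /\
    clash i.+1 F' \subset (clash i F :\ v i) :|: hits i b.
Proof.
move=> lin [Ft F0 Fc Fp] bc bP; exists (fun x => if x == v i then b else F x).
  split; last by rewrite eqxx.
  have out x : x \notin tail i.+1 -> x != v i -> x \notin tail i.
    by move=> xt xv; rewrite tailS // in_setU1 negb_or xv.
  split=> [x xt|x xt|x xt|x y xt yt] /=.
  - case: eqP => [xv|_]; first by move: xt; rewrite xv mem_tail // ltnn.
    by apply: Ft; rewrite tailS // in_setU1 xt orbT.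
  - case: eqP => [xv|_]; last exact: F0.
    by move: xt; rewrite xv inE /= mem_tail.
  - by case: eqP => // /eqP xv; apply: Fc; apply: out.
  - have [->|xv] := eqVneq x (v i); have [->|yv] := eqVneq y (v i) => h.
    + by have := psi_proper h; rewrite eqxx.
    + by rewrite eq_sym bP ?out // H_sym.
    + by rewrite bP // out.
    + by apply: Fp => //; apply: out.
split=> [x /negbTE ->//|].
apply/subsetP => y; rewrite inE => /andP [yt /existsP [x /and3P [xt xy]]].
have yv : y != v i by apply: contraL yt => /eqP ->; rewrite mem_tail // ltnn.
rewrite in_setU; case: (eqVneq x (v i)) => [xv|xv] Fx.
  by apply/orP; right; rewrite /hits in_set yt /= -xv xy eq_sym Fx.
rewrite in_setD1 yv inE (tailS lin) in_setU1 yt orbT /=.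
by apply/orP; left; apply/existsP; exists x; rewrite xy Fx in_setU1 negb_or xv xt.
Qed.

(* The next [k] vertices of the path are not settled yet, so they do not count. *)
Lemma free_color i F : i + k <= n ->
  exists2 b, b < c & forall x, x \notin tail i -> H x (v i) -> F x != b.
Proof.
move=> ikn; pose Y := [set x | (x \notin tail i) && H x (v i)].
have [|b bc bP] := @fresh_color _ Y F c; last first.
  by exists b => // x xt xv; apply: bP; rewrite inE xt.
pose Z := [set y in map v (iota i.+1 k)].
have cZ : #|Z| = k.
  rewrite cardsE -[RHS](size_iota i.+1) -(size_map v); apply/card_uniqP.
  rewrite map_inj_in_uniq ?iota_uniq // => p q; rewrite !mem_iota => pb qb.
  by apply: v_inj; lia.
have dis : Y :&: Z = set0.
  apply/setP => y; rewrite in_setI [y \in set0]in_set0; apply/negP => /andP [].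
  rewrite in_set => /andP [yt _]; rewrite in_set => /mapP [j].
  by rewrite mem_iota => jb yj; move: yt; rewrite yj mem_tail; lia.
have sub : Y :|: Z \subset [set y | H (v i) y].
  apply/subsetP => y; rewrite in_setU ![y \in _]in_set => /orP [/andP [_]|/mapP [j]]; first by rewrite H_sym.
  by rewrite mem_iota => jb ->; rewrite H_path; lia.
by have := subset_leq_card sub; have := H_deg (v i); rewrite cardsU dis cards0 cZ; lia.
Qed.

(** Two path vertices among the [k] successors of [v i] are themselves adjacent in [H], so [psi]
    separates them. *)
Lemma card_hits i b : i + k <= n -> #|hits i b| <= 1.
Proof.
move=> ikn; apply/card_le1_eqP => x y.
rewrite !inE => /and3P [/existsP [p /andP [ip /eqP ->]] xv /eqP xb].
move=> /and3P [/existsP [q /andP [iq /eqP ->]] yv /eqP yb].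
have pn := ltn_ord p; have qn := ltn_ord q.
have := xv; have := yv; rewrite !H_path; [|lia|lia] => qk pk.
have [pq|qp|->//] := ltngtP p q.
- have : H (v p) (v q) by rewrite H_path; lia.
  by move/psi_proper; rewrite xb yb eqxx.
- have : H (v q) (v p) by rewrite H_path; lia.
  by move/psi_proper; rewrite xb yb eqxx.
Qed.

(* The extra color [c] is not used on the last [t] settled vertices of the path. *)
Definition reachable i a t := exists F : T -> nat,
  [/\ settled i F, #|clash i F| <= a
    & forall j, j < i -> i <= j + t -> F (v j) != c].

Lemma reachable0 : reachable 0 0 0.
Proof.
exists psi; split=> //; last first.
  rewrite leqn0 cards_eq0; apply/eqP/setP => y; rewrite !inE.
  apply/negP => /andP [_ /existsP [x /and3P [_ xy]]].
  by rewrite (negbTE (psi_proper xy)).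
split=> // [x xt|x y _ _]; last exact: psi_proper.
by rewrite ltnW // psi_lt // => j jk; apply: contraNneq xt => ->; rewrite mem_tail //; lia.
Qed.

(** Meant for the first [k] vertices, whose [psi]-color may be forbidden: any free color will do, at
    the price of one clash. *)
Lemma reachable_start i a t : i + k <= n -> reachable i a t -> reachable i.+1 a.+1 t.+1.
Proof.
move=> ikn [F [Fs Fa Ft]]; have [b bc bP] := free_color F ikn.
have lin : i <= n by lia.
have [F' [Fs' Fi] [Fo sub]] := settle_next lin Fs (ltnW bc) bP.
exists F'; split=> // [|j]; last first.
  rewrite ltnS leq_eqVlt => /orP [/eqP ->|ji] it; first by rewrite Fi neq_ltn bc.
  rewrite Fo ?Ft //; first by lia.
  by apply/eqP => /v_inj; lia.
apply: leq_trans (subset_leq_card sub) _.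
apply: leq_trans (leq_card_setU _ _).1 _; rewrite -addn1.
apply: leq_add (card_hits _ ikn); apply: leq_trans Fa.
by rewrite subset_leq_card // subsetDl.
Qed.

Lemma psi_path_lt i : k <= i <= n -> psi (v i) < c.
Proof. by move=> ki; apply: psi_lt => j jk; apply/eqP => /v_inj; lia. Qed.

(** Keeping the [psi]-color creates no clash, since [psi] is proper. *)
Lemma settle_keep i F : k <= i <= n -> settled i F -> v i \notin clash i F ->
  exists2 F', settled i.+1 F' /\ F' (v i) = psi (v i) &
    (forall x, x != v i -> F' x = F x) /\ clash i.+1 F' \subset clash i F.
Proof.
move=> kin Fs vi; have lin : i <= n by lia.
have [||F' ? [? sub]] := settle_next (b := psi (v i)) lin Fs.
- by rewrite ltnW // psi_path_lt.
- move=> x xt xv; apply: contra vi => Fx; rewrite inE mem_tail // leqnn /=.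
  by apply/existsP; exists x; rewrite xt xv.
exists F' => //; split=> //; apply: subset_trans sub _.
apply/subsetP => y; rewrite in_setU => /orP [/setD1P []//|].
rewrite inE => /and3P [_ /psi_proper +] /eqP yv; by rewrite yv eqxx.
Qed.

(** If [v i] clashes, its own clash disappears and at most one new clash replaces it. *)
Lemma reachable_next i a t : k <= i -> i + k <= n ->
  reachable i a t -> reachable i.+1 a t.+1.
Proof.
move=> ki ikn [F [Fs Fa Ft]]; have lin : i <= n by lia.
have [vi|vi] := boolP (v i \in clash i F); last first.
  have [|F' [Fs' Fi] [Fo sub]] := settle_keep _ Fs vi; first by rewrite ki.
  exists F'; split=> // [|j]; first exact: leq_trans (subset_leq_card sub) Fa.
  rewrite ltnS leq_eqVlt => /orP [/eqP ->|ji] it; first by rewrite Fi.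
  by rewrite Fo ?Ft //; [lia|apply/eqP => /v_inj; lia].
have [b bc bP] := free_color F ikn.
have [F' [Fs' Fi] [Fo sub]] := settle_next lin Fs (ltnW bc) bP.
exists F'; split=> // [|j]; last first.
  rewrite ltnS leq_eqVlt => /orP [/eqP ->|ji] it; first by rewrite Fi neq_ltn bc.
  by rewrite Fo ?Ft //; [lia|apply/eqP => /v_inj; lia].
apply: leq_trans (subset_leq_card sub) _.
apply: leq_trans (leq_card_setU _ _).1 _; apply: leq_trans Fa.
by rewrite (cardsD1 (v i) (clash i F)) vi addnC leq_add2r card_hits.
Qed.

Lemma reachable_wait s i a t : k <= i -> i + s + k <= n.+1 ->
  reachable i a t -> reachable (i + s) a (t + s).
Proof.
elim: s => [|s IHs] ki iskn h; first by rewrite !addn0.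
by rewrite !addnS; apply: reachable_next; [lia|lia|apply: IHs => //; lia].
Qed.

(** Vertices off the path keep their [psi]-color, so a clash is caused by a path vertex before
    [v i], at most [k] positions back from [y]. *)
Lemma clash_near i F y : settled i F -> y \in clash i F ->
  exists2 d, d < k /\ i + d <= n & y = v (i + d).
Proof.
case=> Ft F0 Fc Fp; rewrite inE => /andP [/tailP [q /andP [iq qn] ->]].
case/existsP => x /and3P [xt xy /eqP Fx].
have [/tailP [p /andP [_ pn] xp]|x0] := boolP (x \in tail 0); last first.
  by have := psi_proper xy; rewrite -Fx F0 ?eqxx.
move: xt xy; rewrite xp mem_tail // -ltnNge => pi; rewrite H_path; last by lia.
by move=> qp; exists (q - i); [lia|rewrite subnKC].
Qed.

(** Color [c] is free at [v i]: no vertex off the path and none of the last [k] settled path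
    vertices has it. As [psi] never takes [c], no new clash arises. *)
Lemma reachable_extra i a F : i <= n -> settled i F ->
  #|clash i F| <= a.+1 -> (forall j, j < i -> i <= j + k -> F (v j) != c) ->
  v i \in clash i F -> reachable i.+1 a 0.
Proof.
move=> lin Fs Fa Ft vi.
have [|F' [Fs' _] [_ sub]] := settle_next lin Fs (leqnn c).
  move=> x xt; have [/tailP [j /andP [_ jn] xj]|x0 _] := boolP (x \in tail 0); last first.
    by case: Fs => _ -> //.
  move: xt; rewrite xj mem_tail // -ltnNge => ji; rewrite H_path; last by lia.
  by move=> ijk; apply: Ft => //; lia.
exists F'; split=> // [|j]; last by rewrite addn0 ltnS => ji; rewrite leqNgt ltnS ji.
apply: leq_trans (subset_leq_card sub) _.
have -> : hits i c = set0.
  by apply/setP => y; rewrite !inE (negbTE (psi_neq y)) !andbF.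
by rewrite setU0; move: Fa; rewrite (cardsD1 (v i)) vi.
Qed.

(** Vertices without a clash keep their [psi]-color, so [c] stays free and the clash at [v (i + d)]
    persists; the first clashing vertex met takes [c]. *)
Lemma reachable_kill d i a F : k <= i -> i + d <= n -> settled i F ->
  #|clash i F| <= a.+1 -> (forall j, j < i -> i <= j + k -> F (v j) != c) ->
  v (i + d) \in clash i F -> exists2 i', i <= i' <= i + d.+1 & reachable i' a 0.
Proof.
elim: d i F => [|d IHd] i F ki idn Fs Fa Ft vd; have lin : i <= n by lia.
  exists i.+1; first by lia.
  by apply: reachable_extra Fs Fa Ft _ => //; rewrite addn0 in vd.
have [vi|vi] := boolP (v i \in clash i F).
  by exists i.+1; [lia|apply: reachable_extra Fs Fa Ft vi].
have [|F' [Fs' Fi] [Fo sub]] := settle_keep _ Fs vi; first by rewrite ki.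
have nv j : j <= n -> j != i -> v j != v i.
  by move=> jn; apply: contra_neq => /v_inj ->.
have [||||||i' ib h] := IHd i.+1 F'; last by exists i' => //; lia.
- lia.
- lia.
- by [].
- exact: leq_trans (subset_leq_card sub) Fa.
- move=> j; rewrite ltnS leq_eqVlt => /orP [/eqP ->|ji] it; first by rewrite Fi.
  by rewrite Fo ?Ft ?nv //; lia.
- move: vd; rewrite /clash 2!in_set addSnnS !mem_tail //.
  case/andP => _ /existsP [x /and3P [xt xy Fx]].
  apply/andP; split; first by lia.
  have xv : x != v i by apply: contraNneq xt => ->; rewrite mem_tail.
  apply/existsP; exists x; rewrite xy Fo // Fx !andbT.
  by move: xt; rewrite tailS // in_setU1 negb_or => /andP [].
Qed.

(** A round removes one clash in at most [2 * k] steps: [k] steps of waiting until [c] is free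
    again, then at most [k] more to settle a clashing vertex. *)
Lemma reachable_empty a i : k <= i -> i + k + a * (2 * k) <= n ->
  reachable i a 0 -> exists2 i', k <= i' & reachable i' 0 0.
Proof.
elim: a i => [|a IHa] i ki ian h; first by exists i.
have ikn : i + k + k <= n.+1 by nia.
have [F [Fs Fa Ft]] := reachable_wait ki ikn h; rewrite add0n in Ft.
(* Waiting alone may already have removed a clash. *)
have [c0|cl] := leqP #|clash (i + k) F| a.
  apply: (IHa (i + k)); [lia|nia|].
  by exists F; split=> // j ji; rewrite addn0 leqNgt ji.
have /card_gt0P [y yc] : 0 < #|clash (i + k) F| by lia.
have [d [dk dn] yd] := clash_near Fs yc; rewrite yd in yc.
have [|i' ib h'] := reachable_kill _ dn Fs Fa Ft yc; first by lia.
by apply: IHa h'; nia.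
Qed.

Lemma recoloring : 3 * k + k * (2 * k) <= n ->
  exists F : T -> nat, (forall x, F x <= c) /\ (forall x y, H x y -> F x != F y).
Proof.
move=> kn; have st i : i <= k -> reachable i i i.
  by elim: i => [|i IHi] ik; [exact: reachable0|apply: reachable_start; [lia|apply: IHi; lia]].
have [F0 [? ? ?]] := st k (leqnn k).
have [||i ki [F [[Ft _ Fc Fp] cl _]]] := @reachable_empty k k (leqnn k); first by lia.
  by exists F0; split=> // j jk; rewrite addn0 leqNgt jk.
(* No clash is pending at [i], so the [psi]-colors on [tail i] are compatible with the settled
   ones. *)
have F_lt x : x \in tail i -> F x < c.
  move=> xt; rewrite Ft //; case/tailP: xt => j jb ->; apply: psi_path_lt; lia.
have cross x y : x \notin tail i -> y \in tail i -> H x y -> F x != F y.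
  move=> xt yt xy; apply/negP => Fxy; move: cl; rewrite leqn0 cards_eq0 => /eqP /setP /(_ y).
  rewrite inE yt in_set0 => /existsP; case; exists x; by rewrite xt xy -Ft.
exists F; split=> [x|x y xy].
  by have [/F_lt /ltnW|xt] := boolP (x \in tail i); last exact: Fc.
have [xt|xt] := boolP (x \in tail i); have [yt|yt] := boolP (y \in tail i).
- by rewrite !Ft // psi_proper.
- by rewrite eq_sym cross // H_sym.
- exact: cross.
- exact: Fp.
Qed.

End Recoloring.

(** * Application to powers of graphs *)

Lemma geodesic_inj (T : finType) (e : rel T) n v i j :
  geodesic e n v -> i <= n -> j <= n -> v i = v j -> i = j.
Proof.
case=> _ vg lin ljn; wlog ij : i j lin ljn / i <= j.
  move=> th; case: (leqP i j) => [|/ltnW] ij; first exact: th.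
  by move/esym => h; apply/esym; apply: th h.
move=> vij; have := vg i j 0; rewrite ij ljn addn0 vij /= eqxx => /(_ isT isT).
by move=> ji; apply/eqP; rewrite eqn_leq ij ji.
Qed.

Lemma graph_pow_geodesic (T : finType) (e : rel T) k n v i j :
  geodesic e n v -> i < j <= n -> graph_pow e k (v i) (v j) = (j - i <= k).
Proof.
move=> vg ijn; have vi := geodesic_inj vg; case: (vg) => ve vm.
have nij : v i != v j by apply/eqP => /vi; lia.
rewrite /graph_pow nij /=; apply/idP/idP => [/vm|]; first by lia.
by move/within_leq; apply; apply: walk_within ve _; lia.
Qed.

Lemma leq_fkD k D : 2 <= D -> k <= fkD k D.
Proof.
move=> D2; rewrite /fkD -[leqLHS]mul1n; apply: leq_mul; first by lia.
rewrite -[leqLHS]card_ord -sum1_card; apply: leq_sum => i _.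
by rewrite expn_gt0; case: D D2 => [|[|]].
Qed.

Lemma chi_graph_pow_leq (T : finType) (e : rel T) k n v :
  symmetric e -> connected e -> 0 < k <= fkD k (max_degree e) ->
  3 * k + k * (2 * k) <= n -> geodesic e n v ->
  chi (graph_pow e k) + k <= (fkD k (max_degree e)).+2.
Proof.
move=> es ec /andP [k0 kf] kn vg; set f := fkD _ _ in kf *.
have vinj := geodesic_inj vg; have vm := graph_pow_geodesic k vg; have [ve _] := vg.
set H := graph_pow e k in vm *.
have Hs : symmetric H by move=> x y; rewrite /H /graph_pow eq_sym within_sym.
have Hi : irreflexive H by move=> x; rewrite /H /graph_pow eqxx.
have Hf x : #|[set y | H x y]| <= f by apply: card_graph_pow.
(* A vertex with at most [f] neighbors, [k] of them outside [A], has fewer than [f.+1 - k] in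
   [A]. *)
pose c := f.+1 - k; pose S := [set x | x \notin map v (iota 0 k)].
have [A AS A0|phi [phi_lt phiP]] := @degenerate_coloring _ H c S Hs Hi.
  have [|||x xA kx] := @boundary_neighbors _ e k v A es ec k0 _ _ _ A0.
  - by move=> i ik; apply: ve; nia.
  - by move=> i j; rewrite !inE => ik jk; apply: vinj; nia.
  - move=> i ik; apply/negP => /(subsetP AS); rewrite inE => /negP; apply.
    by apply: map_f; rewrite mem_iota.
  exists x => //; have := Hf x; rewrite -(cardsID A).
  have -> : [set y | H x y] :&: A = [set y in A | H x y].
    by apply/setP => y; rewrite !inE andbC.
  have -> : [set y | H x y] :\: A = [set y | (y \notin A) && H x y].
    by apply/setP => y; rewrite !inE.
  by move: kx; rewrite /c -/H; lia.
(* the first [k] vertices of the geodesic get distinct colours outside the palette *)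
pose psi x := if x \in S then phi x else c.+1 + index x (map v (iota 0 k)).
have [||||||F [Fc FP]] := @recoloring _ H k c n v psi _ Hs vm vinj.
- by nia.
- by move=> x; have := Hf x; rewrite /c; lia.
- move=> x y xy; rewrite /psi; case: ifP => xS; case: ifP => yS.
  + exact: phiP.
  + by have := phi_lt _ xS; lia.
  + by have := phi_lt _ yS; lia.
  + rewrite eqn_add2l; apply/eqP => /index_inj; move: xS yS.
    rewrite !inE => /negbFE xS /negbFE yS h.
    by move: xy; rewrite h // Hi.
- by move=> x; rewrite /psi; case: ifP => [/phi_lt|_]; lia.
- move=> x xv; rewrite /psi; have xS : x \in S.
    by rewrite inE; apply/mapP => [[j]]; rewrite mem_iota => /xv /eqP.
  by rewrite xS phi_lt.
- by [].
rewrite /chi; case: ex_minnP => m _ mmin.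
have : m <= c.+1; last by rewrite /c; lia.
apply: mmin; apply/existsP; exists [ffun x => Ordinal (Fc x : F x < c.+1)].
apply/forallP => x; apply/forallP => y; apply/implyP => /andP [_ xy].
by rewrite !ffunE -val_eqE /= FP.
Qed.

(* "Only finitely many graphs (up to isomorphism)" is stated as: their orders are bounded. *)
Theorem theorem4 (k D : nat) : 1 <= k -> 3 <= D ->
  exists N : nat, forall (T : finType) (e : rel T),
    symmetric e -> irreflexive e -> connected e ->
    max_degree e = D ->
    (kgap e k < k%:Z - 2%:Z)%R ->
    #|T| <= N.
Proof.
(* Here [n] is the path length that the recoloring asks for, and more than [(fkD n D).+1] vertices
   guarantee a geodesic of that length. *)
move=> k1 D3; pose n := 3 * k + k * (2 * k); exists (fkD n D).+1 => T e es _ ec eD gap.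
rewrite leqNgt; apply/negP => big; rewrite -eD in big.
have [v vg] := geodesic_exists es ec big.
have kf : k <= fkD k (max_degree e) by apply: leq_fkD; rewrite eD; lia.
(* This bound makes the gap at least [k - 1]. *)
have := chi_graph_pow_leq es ec _ (leqnn n) vg; rewrite k1 kf => /(_ isT).
by move: gap; rewrite /kgap; lia.
Qed.
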